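(* Let $N\ge 1$ and $L\ge 1$ be integers and let $m>0$. Let $h_1,\dots,h_N$ be i.i.d. Nakagami-$m$ random variables, i.e. with density $p_h(x)=\frac{2m^m x^{2m-1}}{\Gamma(m)}e^{-mx^2}$ for $x>0$, and set $\gamma_n=h_n^2$ (so each $\gamma_n$ has density $\frac{m^m x^{m-1}}{\Gamma(m)}e^{-mx}$, $x>0$). Define $$R(\mathbf h)^2=\frac{1}{\pi}\,\Gamma\!\left(\frac N2+1\right)^{2/N}\left(\prod_{n=1}^N\gamma_n\right)^{1/N},$$ and for $\rho>0$ define the sphere lower bound $$P_{\rm slb}(\rho)=1-\mathbb E\left[\left(1-\overline{\Gamma}\!\left(\frac N2,\frac{R(\mathbf h)^2}{2}\rho\right)\right)^{L}\right],$$ where the expectation is over $(h_1,\dots,h_N)$ and $\overline\Gamma(a,x)=\frac{1}{\Gamma(a)}\int_x^{\infty}t^{a-1}e^{-t}\,dt$ is the normalized upper incomplete Gamma function. Then the diversity order $$d=-\lim_{\rho\to\infty}\frac{\log P_{\rm slb}(\rho)}{\log\rho}$$ exists and equals $mN$, for every $L\ge 1$.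
   Context: This is the sphere lower bound on the frame error probability of an infinite $N$-dimensional lattice with unit-determinant generator matrix, used over a real block-fading channel $\mathbf y_\ell=\mathrm{diag}(h_1,\dots,h_N)\mathbf x_\ell+\mathbf z_\ell$, $\ell=1,\dots,L$, with i.i.d. $\mathcal N(0,\sigma^2)$ noise and SNR $\rho=1/\sigma^2$; the fading is constant over a frame of $L$ symbols. $\Gamma$ denotes the Gamma function. $P_{\rm slb}(\rho)$ is obtained by replacing the Voronoi region of the faded lattice by a ball of equal volume $\prod_n h_n$, whose squared radius is $R(\mathbf h)^2$. *)

(* Defs.v *)
From HB Require Import structures.
From mathcomp Require Import all_boot all_order all_algebra.
From mathcomp Require Import all_classical all_reals all_analysis.
Set Implicit Arguments. Unset Strict Implicit. Unset Printing Implicit Defensive.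
Import Order.TTheory GRing.Theory Num.Theory.
Import numFieldNormedType.Exports.
Local Open Scope classical_set_scope.
Local Open Scope ring_scope.

Section Defs.
Variable R : realType.
Notation mu := (@lebesgue_measure R).

Definition Gammaf (a : R) : R :=
  Rintegral mu `]0, +oo[ (fun t => t `^ (a - 1) * expR (- t)).

Definition upper_gamma_reg (a x : R) : R :=
  Rintegral mu `]x, +oo[ (fun t => t `^ (a - 1) * expR (- t)) / Gammaf a.

Definition nakagami_pdf (m x : R) : R :=
  2 * m `^ m * x `^ (2 * m - 1) / Gammaf m * expR (- m * x ^+ 2).

(* Expectation of f(h_0,...,h_{n-1}) when h_0..h_{n-1} are i.i.d. with
   density p on (0,+oo): iterated Lebesgue integral (coordinate n-1 outermost).
   Entries of the argument vector with index >= n are irrelevant (set to 0). *)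
Fixpoint iid_expect (p : R -> R) (n : nat) (f : (nat -> R) -> R) : R :=
  match n with
  | 0 => f (fun _ => 0)
  | n'.+1 => Rintegral mu `]0, +oo[
      (fun x => p x * iid_expect p n' (fun v => f (fun k => if k == n' then x else v k)))
  end.

Definition sphere_radius2 (N : nat) (h : nat -> R) : R :=
  (Gammaf (N%:R / 2 + 1)) `^ (2 / N%:R) / pi
  * (\prod_(i < N) (h i) ^+ 2) `^ (1 / N%:R).

Definition P_slb (N L : nat) (m rho : R) : R :=
  1 - iid_expect (nakagami_pdf m) N
        (fun h => (1 - upper_gamma_reg (N%:R / 2) (sphere_radius2 N h / 2 * rho)) ^+ L).
End Defs.

(* Main.v *)
Require Import Defs.
From HB Require Import structures.
From mathcomp Require Import all_boot all_order all_algebra.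
From mathcomp Require Import all_classical all_reals all_analysis.
From mathcomp Require Import measurable_realfun ring lra.
Import Order.TTheory GRing.Theory Num.Theory.
Import numFieldNormedType.Exports.
Local Open Scope classical_set_scope.
Local Open Scope ring_scope.

(** With s = h_1^2 ... h_N^2, one has P_slb(rho) = E[u(s)] where
    u(s) = 1 - (1 - Q(N/2, K rho s^(1/N) / 2))^L is nonincreasing in s, Q being
    the normalized upper incomplete Gamma function.

    Upper bound: Markov's inequality for a negative moment.  For j > 0,
    Q(a, x) <= Gamma(a + j) / Gamma(a) x^(-j); with j = k N this yields
    u(s) <= C rho^(-k N) s^(-k), and E[h^(-2k)] is finite for every k < m,
    hence P_slb(rho) = O(rho^(-k N)) for all k < m.

    Lower bound: on the event that every h_n lies in [d/2, d], d^2 = 1/rho, one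
    has u(s) >= Q(N/2, K / 2) > 0, and this event has probability at least
    (c d^(2m))^N = c^N rho^(-m N). *)

Section aux.
Context {R : realType}.
Local Notation mu := (@lebesgue_measure R).
Implicit Types (p g f : R -> R) (a b c d j k m s t x y rho : R) (n N L : nat).

(** * Measurability and comparison of integrals *)

(** The rays [[r, +oo[] generate the Borel sets, and their preimages under a nonincreasing function
    are order-convex, hence intervals. *)
Lemma nonincreasing_itv_measurable (I : interval R) f :
  {in I &, {homo f : x y / x <= y >-> y <= x}} ->
  measurable_fun [set` I] f.
Proof.
move=> f_ni; apply: (measurability (@RGenCInfty.G R)) => [|/= _ [_] [r] -> <-].
  exact: RGenCInfty.measurableE.
apply: is_interval_measurable => s t /=.
have ge_r x : (f x \in `[r, +oo[) = (r <= f x) by rewrite in_itv/= andbT.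
move=> [Is]; rewrite ge_r => fs [It]; rewrite ge_r => ft u /andP[su ut].
have Iu : [set` I] u.
  have := @interval_is_interval R I s t Is It u; rewrite su ut; exact.
by split => //; rewrite ge_r (le_trans ft)// f_ni.
Qed.

Lemma Rintegral_ge_cst_itv (D : set R) f (a b c : R) : measurable D ->
  mu.-integrable D (EFin \o f) -> (forall x, D x -> 0 <= f x) ->
  a <= b -> `[a, b] `<=` D -> (forall x, a <= x <= b -> c <= f x) ->
  c * (b - a) <= Rintegral mu D f.
Proof.
move=> mD fint f0 ab abD cf.
have fiab : mu.-integrable `[a, b] (EFin \o f) by exact: integrableS fint.
apply: (@le_trans _ _ (Rintegral mu `[a, b] f)).
  have -> : c * (b - a) = \int[mu]_(x in `[a, b]) c.
    rewrite Rintegral_cst//= lebesgue_measure_itv/= lte_fin.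
    have [//|ba|->] := ltgtP a b; last by rewrite subrr.
    by move: ab; rewrite leNgt ba.
  apply: le_Rintegral => //.
  apply: continuous_compact_integrable; first exact: segment_compact.
  exact/continuous_subspaceT/cst_continuous.
rewrite /Rintegral fine_le//.
- exact: integrable_fin_num.
- exact: integrable_fin_num.
- apply: ge0_subset_integral => //.
  exact: measurable_int fint.
Qed.

Lemma integrable_le1M (D : set R) p f : measurable D ->
  mu.-integrable D (EFin \o p) -> measurable_fun D f ->
  (forall x, D x -> 0 <= f x <= 1) ->
  mu.-integrable D (EFin \o (fun x => p x * f x)).
Proof.
move=> mD ip mf f01; apply: le_integrable (ip) => //.
  apply/measurable_EFinP; apply: measurable_funM => //.
  by apply/measurable_EFinP; exact: measurable_int ip.
move=> x /f01 /andP[f0 f1] /=; rewrite lee_fin normrM ler_piMr// ger0_norm//.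
Qed.

Lemma integrableZl_EFin (D : set R) f (r : R) : measurable D ->
  mu.-integrable D (EFin \o f) ->
  mu.-integrable D (EFin \o (fun x => r * f x)).
Proof. by move=> mD fi; exact: (@integrableZl _ _ _ mu D mD r (EFin \o f) fi). Qed.

(** * Iterated expectations of a function of a product of squares *)

(** The free scale [s] is what allows induction on [n]: fixing the outermost coordinate at [x]
    leaves the same expectation in one variable less, at scale [s * x ^+ 2]. *)
Definition prod_mean p g (n : nat) (s : R) :=
  iid_expect p n (fun v => g (s * \prod_(i < n) v i ^+ 2)).

Lemma prod_mean0 p g s : prod_mean p g 0 s = g s.
Proof. by rewrite /prod_mean/= big_ord0 mulr1. Qed.

Lemma prod_meanS p g n s : prod_mean p g n.+1 s =
  \int[mu]_(x in `]0, +oo[) (p x * prod_mean p g n (s * x ^+ 2)).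
Proof.
rewrite /prod_mean/=; congr Rintegral; apply/funext => x; congr (_ * _).
congr iid_expect; apply/funext => v; congr g.
rewrite big_ord_recr/= eqxx -mulrA; congr (_ * _); rewrite mulrC.
congr (_ * _); apply: eq_bigr => i _.
by rewrite ltn_eqF.
Qed.

Section prod_mean.
Context (p g : R -> R).
Hypothesis p0 : forall x, 0 < x -> 0 <= p x.
Hypothesis ip : mu.-integrable `]0, +oo[ (EFin \o p).
Hypothesis p1 : \int[mu]_(x in `]0, +oo[) p x = 1.
Hypothesis g_ni : forall s t, 0 < s -> s <= t -> g t <= g s.
Hypothesis g01 : forall s, 0 < s -> 0 <= g s <= 1.

(* Monotonicity of [g] is what makes the inner integrals measurable in the outer
   variable. *)
Lemma prod_mean_decr n :
  (forall s t, 0 < s -> s <= t -> prod_mean p g n t <= prod_mean p g n s) /\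
  (forall s, 0 < s -> 0 <= prod_mean p g n s <= 1) /\
  (forall s, 0 < s -> mu.-integrable `]0, +oo[
      (EFin \o (fun x => p x * prod_mean p g n (s * x ^+ 2)))).
Proof.
(* Monotonicity and bounds at one level give integrability at that level, and the next level needs
   that integrability to compare its integrals; hence the three claims are proved together. *)
have istep n' : (forall s t, 0 < s -> s <= t -> prod_mean p g n' t <= prod_mean p g n' s) ->
  (forall s, 0 < s -> 0 <= prod_mean p g n' s <= 1) ->
  (forall s, 0 < s -> mu.-integrable `]0, +oo[
      (EFin \o (fun x => p x * prod_mean p g n' (s * x ^+ 2)))).
  move=> niE E01 s s0; apply: integrable_le1M => //=.
    apply: nonincreasing_itv_measurable => x y.
    rewrite !in_itv/= !andbT => x0 y0 xy.
    by apply: niE; rewrite ?mulr_gt0 ?exprn_gt0// ler_pM2l// lerXn2r// nnegrE ltW.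
  by move=> x; rewrite /= in_itv/= andbT => x0; rewrite E01// mulr_gt0// exprn_gt0.
elim: n => [|n [niE [E01 iE]]].
  have h1 s t : 0 < s -> s <= t -> prod_mean p g 0 t <= prod_mean p g 0 s.
    by rewrite !prod_mean0; exact: g_ni.
  have h2 s : 0 < s -> 0 <= prod_mean p g 0 s <= 1.
    by rewrite !prod_mean0; exact: g01.
  by split => //; split => //; exact: istep.
have h1 s t : 0 < s -> s <= t -> prod_mean p g n.+1 t <= prod_mean p g n.+1 s.
  move=> s0 st; rewrite !prod_meanS; apply: le_Rintegral => //.
  - by apply: iE; exact: lt_le_trans st.
  - exact: iE.
  move=> x /=; rewrite in_itv/= andbT => x0; apply: ler_wpM2l; first exact: p0.
  by apply: niE; rewrite ?mulr_gt0 ?exprn_gt0// ler_pM2r// exprn_gt0.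
have h2 s : 0 < s -> 0 <= prod_mean p g n.+1 s <= 1.
  move=> s0; rewrite prod_meanS; apply/andP; split.
    apply: Rintegral_ge0 => x /=; rewrite in_itv/= andbT => x0.
    have /andP[? _] := E01 (s * x ^+ 2) (mulr_gt0 s0 (exprn_gt0 2 x0)).
    by rewrite mulr_ge0 ?p0.
  rewrite -[leRHS]p1; apply: le_Rintegral => //; first exact: iE.
  move=> x /=; rewrite in_itv/= andbT => x0.
  have /andP[_ ?] := E01 (s * x ^+ 2) (mulr_gt0 s0 (exprn_gt0 2 x0)).
  by rewrite ler_piMr ?p0.
by split => //; split => //; exact: istep.
Qed.

(** Linearity, applied one integral at a time. It serves to rewrite the bound, defined as one minus
    the mean probability of success, as a mean probability of error. *)
Lemma prod_mean_onem n s : 0 < s ->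
  prod_mean p (fun t => 1 - g t) n s = 1 - prod_mean p g n s.
Proof.
elim: n s => [|n IH] s s0; first by rewrite !prod_mean0.
have [_ [_ iE]] := prod_mean_decr n.
rewrite !prod_meanS -[X in X - _]p1 -RintegralB//; last exact: iE.
apply: eq_Rintegral => x; rewrite inE/= in_itv/= andbT => x0.
by rewrite IH ?mulr_gt0 ?exprn_gt0// mulrBr mulr1.
Qed.

(** Since the power [- k] is multiplicative, each coordinate integrated out contributes one factor
    equal to the moment of order [- 2 k] of the density. *)
Lemma prod_mean_le (C k : R) n s : 0 <= C ->
  mu.-integrable `]0, +oo[ (EFin \o (fun x => p x * (x ^+ 2) `^ (- k))) ->
  (forall t, 0 < t -> g t <= C * t `^ (- k)) -> 0 < s ->
  prod_mean p g n s <=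
    C * (\int[mu]_(x in `]0, +oo[) (p x * (x ^+ 2) `^ (- k))) ^+ n * s `^ (- k).
Proof.
move=> C0 ik gC; set M := \int[mu]_(x in _) _.
elim: n s => [|n IH] s s0; first by rewrite prod_mean0 expr0 mulr1 gC.
have [_ [_ iE]] := prod_mean_decr n.
have -> : C * M ^+ n.+1 * s `^ (- k) = (C * M ^+ n * s `^ (- k)) * M.
  by rewrite exprSr; ring.
rewrite prod_meanS -RintegralZl//; apply: le_Rintegral => //.
- exact: iE.
- exact: integrableZl_EFin.
move=> x /=; rewrite in_itv/= andbT => x0.
rewrite [leRHS]mulrCA; apply: ler_wpM2l; first exact: p0.
apply: le_trans (IH _ _) _; first by rewrite mulr_gt0// exprn_gt0.
by rewrite powRM ?(ltW s0) ?sqr_ge0// mulrA.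
Qed.

(** Each coordinate is restricted to [[d / 2, d]], an interval of mass at least [c * (d / 2)]. There
    [x ^+ 2 <= d ^+ 2], so by monotonicity each square may be replaced by [d ^+ 2]. *)
Lemma prod_mean_ge (c d : R) n s : 0 <= c -> 0 < d ->
  (forall x, d / 2 <= x <= d -> c <= p x) -> 0 < s ->
  g (s * d ^+ 2 ^+ n) * (c * (d / 2)) ^+ n <= prod_mean p g n s.
Proof.
move=> c0 d0 cp; elim: n s => [|n IH] s s0.
  by rewrite prod_mean0 !expr0 !mulr1.
have [niE [E01 iE]] := prod_mean_decr n.
have sd0 : 0 < s * d ^+ 2 by rewrite mulr_gt0 ?exprn_gt0.
rewrite prod_meanS.
have d2 : d / 2 = d - d / 2 by lra.
(* One factor [d ^+ 2] moves into the scale, to match the induction hypothesis at [s * d ^+ 2], and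
   one factor [d / 2] becomes the length of the interval. *)
have -> : g (s * d ^+ 2 ^+ n.+1) * (c * (d / 2)) ^+ n.+1 =
    c * (g (s * d ^+ 2 * d ^+ 2 ^+ n) * (c * (d / 2)) ^+ n) * (d - d / 2).
  by rewrite -d2 (exprS (d ^+ 2)) (mulrA s) (exprSr (c * (d / 2))); ring.
apply: Rintegral_ge_cst_itv => //.
- exact: iE.
- move=> x /=; rewrite in_itv/= andbT => x0.
  have /andP[? _] := E01 (s * x ^+ 2) (mulr_gt0 s0 (exprn_gt0 2 x0)).
  by rewrite mulr_ge0 ?p0.
- lra.
- by move=> x /=; rewrite !in_itv/= andbT => /andP[? _]; lra.
move=> x /andP[dx xd]; have x0 : 0 < x by lra.
apply: ler_pM => //.
- have /andP[? _] := g01 (s * d ^+ 2 * d ^+ 2 ^+ n) (mulr_gt0 sd0 (exprn_gt0 n (exprn_gt0 2 d0))).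
  by rewrite mulr_ge0 ?exprn_ge0 ?mulr_ge0// ?divr_ge0 ?(ltW d0).
- by apply: cp; rewrite dx xd.
apply: le_trans (IH _ sd0) _.
by apply: niE; rewrite ?mulr_gt0 ?exprn_gt0// ler_pM2l// lerXn2r// nnegrE ltW.
Qed.
End prod_mean.

(** * Exhaustion of the half-line by segments, and quadratic substitution *)

(** Monotone convergence along growing segments. It carries the fundamental theorem of calculus and
    the change of variables from segments to the half-line. *)
Lemma cvg_integral_itv0y f (a b : nat -> R) :
  nonincreasing_seq a -> nondecreasing_seq b -> (forall i, 0 < a i) ->
  a @ \oo --> 0 -> b @ \oo --> +oo ->
  measurable_fun (`]0, +oo[ : set R) f -> (forall x, 0 < x -> 0 <= f x) ->
  (\int[mu]_(x in `[a i, b i]) (f x)%:E)%E @[i --> \oo] -->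
    (\int[mu]_(x in `]0%R, +oo[) (f x)%:E)%E.
Proof.
move=> a_ni b_nd a0 a_cvg b_cvg mf f0.
have F_pos i : `[a i, b i] `<=` `]0, +oo[.
  by move=> x /=; rewrite !in_itv/= andbT => /andP[+ _]; exact: lt_le_trans.
have -> : `]0%R, +oo[%classic = \bigcup_i `[a i, b i]%classic :> set R.
  apply/seteqP; split => [x /=|x [i _]]; last exact: F_pos.
  rewrite in_itv/= andbT => x0.
  have ax : \forall i \near \oo, a i <= x.
    exact: (cvgr_le _ a_cvg).
  have bx : \forall i \near \oo, x <= b i.
    by move/cvgryPge : b_cvg; exact.
  near \oo => i; exists i => //=; rewrite in_itv/=; apply/andP; split.
    by near: i.
  by near: i.
apply: ge0_nondecreasing_set_cvg_integral => //.
- move=> i j ij; rewrite subsetEset; apply: subset_itv; rewrite bnd_simp.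
    exact: a_ni.
  exact: b_nd.
- move=> i; apply/measurable_EFinP; apply: measurable_funS mf => //.
- move=> i x /F_pos /=; rewrite in_itv/= andbT => /f0; by rewrite lee_fin.
Unshelve. all: by end_near. Qed.

(** These endpoints are chosen so that [x |-> b * x ^+ 2] maps the segments for exponent 1 and scale
    1 onto those for exponent 2 and scale [b]. *)
Lemma cvg_scaled_exprn (n : nat) (b : R) : 0 < b -> (0 < n)%N ->
  let u i : R := b * i.+1%:R ^- n in let v i : R := b * i.+1%:R ^+ n in
  [/\ nonincreasing_seq u, nondecreasing_seq v, (forall i, 0 < u i),
     u @ \oo --> 0 & v @ \oo --> +oo].
Proof.
move=> b0 n0 u v.
have vge i : b * i.+1%:R <= v i.
  by rewrite /v ler_pM2l// ler_eXnr ?ler1n.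
split.
- move=> i j ij; rewrite /u ler_pM2l// lef_pV2 ?posrE ?exprn_gt0//.
  by rewrite lerXn2r ?nnegrE// ler_nat.
- move=> i j ij; rewrite /v ler_pM2l//.
  by rewrite lerXn2r ?nnegrE// ler_nat.
- by move=> i; rewrite mulr_gt0// invr_gt0 exprn_gt0.
- apply: (@squeeze_cvgr _ _ _ _ (cst 0) (fun i => b * harmonic i)).
  + apply: nearW => i; rewrite mulr_ge0 ?invr_ge0 ?exprn_ge0 ?(ltW b0)//=.
    rewrite /u ler_pM2l// lef_pV2 ?posrE ?exprn_gt0//.
    by rewrite ler_eXnr ?ler1n.
  + exact: cvg_cst.
  + by rewrite -[X in _ --> X](mulr0 b); apply: cvgMr; exact: cvg_harmonic.
- apply/cvgryPge => A; near=> i; apply: le_trans (vge i).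
  rewrite -ler_pdivrMl// (@le_trans _ _ i%:R) ?ler_nat//.
  by near: i; exact: nbhs_infty_ger.
Unshelve. all: by end_near. Qed.

Lemma derivable_itv0y_LRcontinuous f (a b : R) :
  (forall x, 0 < x -> derivable f x 1) -> 0 < a -> a < b ->
  derivable_oo_LRcontinuous f a b.
Proof.
move=> df a0 ab.
have cf x : 0 < x -> {for x, continuous f}.
  by move=> x0; apply: differentiable_continuous; apply/derivable1_diffP/df.
split.
- by move=> x; rewrite in_itv/= => /andP[ax _]; apply: df; exact: lt_trans ax.
- by apply: cvg_at_right_filter; exact: cf.
- by apply: cvg_at_left_filter; apply: cf; exact: lt_trans ab.
Qed.

Lemma continuous_within_itv_gt0 f (a b : R) :
  (forall x, 0 < x -> {for x, continuous f}) -> 0 < a ->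
  {within `[a, b], continuous f}.
Proof.
move=> cf a0; apply: continuous_in_subspaceT => x; rewrite inE/= in_itv/=.
by move=> /andP[ax _]; apply: cf; exact: lt_le_trans ax.
Qed.

Lemma continuous_itv0y_measurable f :
  (forall x, 0 < x -> {for x, continuous f}) -> measurable_fun (`]0, +oo[ : set R) f.
Proof.
move=> cf; apply: open_continuous_measurable_fun => // x.
by rewrite inE/= in_itv/= andbT; exact: cf.
Qed.

Lemma continuous_powR (a x : R) : 0 < x -> {for x, continuous (fun t : R => t `^ a)}.
Proof.
move=> x0; apply: differentiable_continuous; apply/derivable1_diffP.
by apply: derivable_powR; rewrite in_itv/= x0.
Qed.

Lemma sqr_substitution f (b : R) : 0 < b ->
  (forall x, 0 < x -> {for x, continuous f}) -> (forall x, 0 < x -> 0 <= f x) ->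
  (\int[mu]_(x in `]0%R, +oo[) (f x)%:E)%E =
  (\int[mu]_(x in `]0%R, +oo[) (f (b * x ^+ 2) * (2 * b * x))%:E)%E.
Proof.
move=> b0 cf f0.
pose F x : R := b * x ^+ 2.
have dF (x : R) : is_derive x (1 : R) F (2 * b * x).
  rewrite /F; apply: is_derive_eq.
  by rewrite /GRing.scale/=; ring.
have dF1 : F^`()%classic = (fun x => 2 * b * x).
  by apply/funext => x; rewrite derive1E; exact: derive_val.
have cdF (x : R) : {for x, continuous (fun x : R => 2 * b * x)}.
  by apply: continuousM; [exact: cst_continuous|exact: cvg_id].
have cF (x : R) : {for x, continuous F}.
  by apply: differentiable_continuous; apply/derivable1_diffP; exact: ex_derive.
have [a_ni b_nd a0 a_cvg b_cvg] := cvg_scaled_exprn 1%N 1 ltr01 isT.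
have [a_ni' b_nd' a0' a_cvg' b_cvg'] := cvg_scaled_exprn 2%N b b0 isT.
have c1 := cvg_integral_itv0y f _ _ a_ni' b_nd' a0' a_cvg' b_cvg'
  (continuous_itv0y_measurable f cf) f0.
have ch (x : R) : 0 < x -> {for x, continuous (fun x : R => f (b * x ^+ 2) * (2 * b * x))}.
  move=> x0; apply: continuousM => //.
  by apply: continuous_comp; [exact: cF|apply: cf; rewrite mulr_gt0 ?exprn_gt0].
have h0 x : 0 < x -> 0 <= f (b * x ^+ 2) * (2 * b * x).
  by move=> x0; rewrite !mulr_ge0 ?(ltW x0) ?(ltW b0)// f0// mulr_gt0 ?exprn_gt0.
have c2 := cvg_integral_itv0y _ _ _ a_ni b_nd a0 a_cvg b_cvg
  (continuous_itv0y_measurable _ ch) h0.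
apply: (cvg_unique _ c1) => //.
(* The two approximating sequences coincide term by term, by substitution on each segment, so their
   limits agree. *)
suff <- : (fun i => \int[mu]_(x in `[(1 * i.+1%:R ^- 1)%R, (1 * i.+1%:R ^+ 1)%R]) (f (b * x ^+ 2) * (2 * b * x))%:E)%E =
   (fun i => \int[mu]_(x in `[(b * i.+1%:R ^- 2)%R, (b * i.+1%:R ^+ 2)%R]) (f x)%:E)%E by [].
apply/funext => i; rewrite !mul1r !expr1.
have i0 : 0 < i.+1%:R^-1 :> R by rewrite invr_gt0.
have := @integration_by_substitution_increasing _ F f (i.+1%:R^-1) (i.+1%:R).
rewrite /F exprVn => -> //; first by rewrite dF1.
- by rewrite (@le_trans _ _ 1)// ?invf_le1// ler1n.
- move=> x y; rewrite !in_itv/= => /andP[ix _] /andP[iy _] xy.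
  by rewrite ltr_pM2l// ltr_pXn2r// nnegrE ltW//; apply: lt_le_trans i0 _.
- by rewrite dF1 => x _; exact: cdF.
- rewrite dF1; apply: cvgP; apply: cvg_at_right_filter; exact: cdF.
- rewrite dF1; apply: cvgP; apply: cvg_at_left_filter; exact: cdF.
- split=> [x _||]; first exact: ex_derive.
  + by apply: cvg_at_right_filter; exact: cF.
  + by apply: cvg_at_left_filter; exact: cF.
- by apply: continuous_within_itv_gt0 => //; rewrite mulr_gt0// invr_gt0 exprn_gt0.
Qed.

(** * The Gamma integral and its upper tail *)

(** Raise [t / k <= expR (t / k)] to the power [k]. *)
Lemma powR_le_expR (k t : R) : 0 < k -> 0 < t -> t `^ k <= k `^ k * expR t.
Proof.
move=> k0 t0; have : t <= k * expR (t / k).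
  have := expR_ge1Dx (t / k); rewrite -(ler_pM2l k0) mulrDr mulrCA divff ?gt_eqF//.
  by move=> h; apply: le_trans h; rewrite !mulr1 lerDr ltW.
have tk0 : 0 <= expR (t / k) := expR_ge0 _.
move=> /(@ge0_ler_powR _ k (ltW k0)); rewrite !nnegrE => /(_ (ltW t0)) h.
apply: le_trans (h _) _; first by rewrite mulr_ge0// ltW.
by rewrite powRM ?(ltW k0)// -expRM divfK ?gt_eqF.
Qed.

Definition gamma_integrand (a t : R) := t `^ (a - 1) * expR (- t).

Lemma gamma_integrand_gt0 (a t : R) : 0 < t -> 0 < gamma_integrand a t.
Proof. by move=> t0; rewrite mulr_gt0 ?powR_gt0 ?expR_gt0. Qed.

Lemma gamma_integrand_continuous (a t : R) : 0 < t ->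
  {for t, continuous (gamma_integrand a)}.
Proof.
move=> t0; apply: continuousM; first exact: continuous_powR.
by apply: continuous_comp; [exact: continuousN|exact: continuous_expR].
Qed.

(* [t^(a-1) e^-t] is dominated by a multiple of the derivative of the bounded
   function [- 1 / (1 + t^a)], which works for all [a > 0], at 0 and at +oo. *)
Lemma gamma_integrable (a : R) : 0 < a ->
  mu.-integrable `]0, +oo[ (EFin \o gamma_integrand a).
Proof.
move=> a0.
pose F (t : R) : R := - (1 + t `^ a)^-1.
pose h (t : R) : R := a * t `^ (a - 1) * (1 + t `^ a) ^- 2.
have q0 t : 0 < 1 + t `^ a by rewrite ltr_pwDl// powR_ge0.
have dF (t : R) : 0 < t -> is_derive t (1 : R) F (h t).
  move=> t0; rewrite /F.
  have d1 := @is_derive1_powR R a _ t0.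
  have d2 : is_derive t (1 : R) (cst 1 + (fun t : R => t `^ a)) (a * t `^ (a - 1)).
    by apply: is_derive_eq; rewrite add0r.
  have d3 := @is_deriveV R (cst 1 + (fun t : R => t `^ a)) t _ 1 (lt0r_neq0 (q0 t)) d2.
  apply: (is_derive_eq (is_deriveN d3)).
  by rewrite /h /GRing.scale/= mulNr opprK mulrC.
have ch (t : R) : 0 < t -> {for t, continuous h}.
  move=> t0; have cp := continuous_powR a t t0; apply: continuousM.
    by apply: continuousM; [exact: cst_continuous|exact: continuous_powR].
  apply: (@continuousV _ _ (fun t : R => (1 + t `^ a) ^+ 2)).
    by rewrite gt_eqF// exprn_gt0.
  by apply: (@continuousM _ _ (fun t : R => 1 + t `^ a) (fun t : R => 1 + t `^ a));
    apply: continuousD => //; exact: cst_continuous.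
have h0 t : 0 < t -> 0 <= h t.
  by move=> t0; rewrite /h !mulr_ge0 ?powR_ge0 ?(ltW a0)// invr_ge0 exprn_ge0// ltW.
have [a_ni b_nd an0 a_cvg b_cvg] := cvg_scaled_exprn 1%N 1 ltr01 isT.
have c1 := cvg_integral_itv0y h _ _ a_ni b_nd an0 a_cvg b_cvg
  (continuous_itv0y_measurable h ch) h0.
(* On each segment the integral of [h] is an increment of [F], whose values lie between -1 and 0. *)
have h_le1 : (\int[mu]_(x in `]0%R, +oo[) (h x)%:E <= 1)%E.
  rewrite -(cvg_lim _ c1)//; apply: lime_le; first by apply/cvg_ex; eexists; exact: c1.
  apply: nearW => i; rewrite !mul1r !expr1.
  have i0 : 0 < i.+1%:R^-1 :> R by rewrite invr_gt0.
  have : i.+1%:R^-1 <= i.+1%:R :> R.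
    by rewrite (@le_trans _ _ 1)// ?invf_le1// ler1n.
  (* For [i = 0] the segment is the single point 1, which is treated apart because the fundamental
     theorem requires distinct endpoints. *)
  rewrite le_eqVlt => /predU1P[->|ab]; first by rewrite set_itv1 integral_set1.
  rewrite (@continuous_FTC2 _ h F)//.
  - rewrite lee_fin /F opprK.
    have : (1 + i.+1%:R^-1 `^ a)^-1 <= 1 by rewrite invf_le1// lerDl powR_ge0.
    have : 0 <= (1 + i.+1%:R `^ a)^-1 by rewrite invr_ge0 ltW.
    lra.
  - exact: continuous_within_itv_gt0.
  - apply: derivable_itv0y_LRcontinuous => // x x0.
    by have := dF _ x0 => -[].
  - move=> x; rewrite in_itv/= => /andP[ix _]; rewrite derive1E.
    by have [_ ->] := dF x (lt_trans i0 ix).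
have ih : mu.-integrable `]0, +oo[ (EFin \o h).
  apply/integrableP; split; first by apply/measurable_EFinP; exact: continuous_itv0y_measurable.
  apply: le_lt_trans (ltry 1); apply: le_trans h_le1.
  rewrite le_eqVlt; apply/orP; left; apply/eqP; apply: eq_integral => x.
  by rewrite inE/= in_itv/= andbT => x0; rewrite ger0_norm ?h0.
(* The factor [a^-1] cancels the [a] in [h]. The rest comes from [(1 + y)^2 <= 2 + 2 y^2] with
   [y = x ^ a], together with [1 <= expR x] and the bound of [powR_le_expR] on [x ^ (2 a)]. *)
pose C : R := a^-1 * (2 + 2 * (2 * a) `^ (2 * a)).
apply: (le_integrable _ _ _ (integrableZl_EFin _ h C _ ih)) => //.
  by apply/measurable_EFinP; apply: continuous_itv0y_measurable => x; exact: gamma_integrand_continuous.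
move=> x /=; rewrite in_itv/= andbT => x0.
have C0 : 0 < C.
  by rewrite mulr_gt0 ?invr_gt0// ltr_pwDl// mulr_ge0// powR_ge0.
rewrite lee_fin (ger0_norm (ltW (gamma_integrand_gt0 a x x0))).
rewrite (ger0_norm (mulr_ge0 (ltW C0) (h0 x x0))).
rewrite /gamma_integrand /h /C.
have -> : a^-1 * (2 + 2 * (2 * a) `^ (2 * a)) * (a * x `^ (a - 1) * (1 + x `^ a) ^- 2) =
   x `^ (a - 1) * ((2 + 2 * (2 * a) `^ (2 * a)) / (1 + x `^ a) ^+ 2).
  by field; rewrite (gt_eqF a0) gt_eqF.
apply: ler_wpM2l; first exact: powR_ge0.
rewrite ler_pdivlMr ?exprn_gt0// expRN mulrC ler_pdivrMr ?expR_gt0//.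
have a20 : 0 < 2 * a by rewrite mulr_gt0.
have := powR_le_expR (2 * a) x a20 x0.
rewrite (mulrC 2 a) powRrM (powR_mulrn _ (powR_ge0 _ _)) => hx.
have := expR_ge1Dx x => e1.
have := sqr_ge0 (1 - x `^ a).
nra.
Qed.

Lemma gamma_integrableS a x : 0 < a -> 0 <= x ->
  mu.-integrable `]x, +oo[ (EFin \o gamma_integrand a).
Proof.
move=> a0 x0; apply: integrableS (gamma_integrable a a0) => //.
by move=> t /=; rewrite !in_itv/= !andbT; exact: le_lt_trans.
Qed.

Lemma Rintegral_gamma_gt0 a x : 0 < a -> 0 <= x ->
  0 < \int[mu]_(t in `]x, +oo[) gamma_integrand a t.
Proof.
move=> a0 x0.
(* A lower bound of the integrand on [[x + 1, x + 2]]. Writing [t ^ (a - 1)] as [t ^ a / t] and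
   bounding each part separately avoids splitting on the sign of [a - 1]. *)
pose c : R := (x + 1) `^ a / (x + 2) * expR (- (x + 2)).
have c0 : 0 < c.
  by rewrite mulr_gt0 ?expR_gt0// divr_gt0 ?powR_gt0//; lra.
apply: (@lt_le_trans _ _ (c * ((x + 2) - (x + 1)))).
  by rewrite mulr_gt0//; lra.
apply: Rintegral_ge_cst_itv => //.
- exact: gamma_integrableS.
- move=> t /=; rewrite in_itv/= andbT => xt.
  by apply/ltW/gamma_integrand_gt0; exact: le_lt_trans xt.
- lra.
- by move=> t /=; rewrite !in_itv/= andbT => /andP[? _]; lra.
move=> t /andP[xt tx]; have t0 : 0 < t by lra.
rewrite /c /gamma_integrand; apply: ler_pM.
- by rewrite divr_ge0 ?powR_ge0//; lra.
- exact: expR_ge0.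
- rewrite powRB ?(gt_eqF t0) ?implybT// powRr1 ?(ltW t0)//.
  apply: ler_pM; rewrite ?powR_ge0 ?invr_ge0//; first lra.
    by apply: ge0_ler_powR; rewrite ?nnegrE; lra.
  by rewrite lef_pV2// posrE; lra.
- by rewrite ler_expR; lra.
Qed.

Lemma Gammaf_gt0 a : 0 < a -> 0 < Gammaf a.
Proof. by move=> a0; exact: Rintegral_gamma_gt0. Qed.

Lemma upper_gamma_reg_gt0 a x : 0 < a -> 0 <= x -> 0 < upper_gamma_reg a x.
Proof.
by move=> a0 x0; rewrite divr_gt0 ?Gammaf_gt0//; exact: Rintegral_gamma_gt0.
Qed.

Lemma upper_gamma_reg_decr a x y : 0 < a -> 0 <= x -> x <= y ->
  upper_gamma_reg a y <= upper_gamma_reg a x.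
Proof.
move=> a0 x0 xy; rewrite ler_pM2r ?invr_gt0 ?Gammaf_gt0//.
rewrite /Rintegral fine_le//.
- by apply: integrable_fin_num => //; apply: gamma_integrableS => //; lra.
- by apply: integrable_fin_num => //; apply: gamma_integrableS.
apply: ge0_subset_integral => //.
- by apply: (@measurable_int _ _ _ mu); apply: gamma_integrableS.
- move=> t /=; rewrite in_itv/= andbT => xt; rewrite lee_fin.
  by apply/ltW/(gamma_integrand_gt0 a); exact: le_lt_trans xt.
- by move=> t /=; rewrite !in_itv/= !andbT; exact: le_lt_trans.
Qed.

Lemma upper_gamma_reg_le1 a x : 0 < a -> 0 <= x -> upper_gamma_reg a x <= 1.
Proof.
move=> a0 x0; apply: le_trans (upper_gamma_reg_decr _ _ _ a0 (lexx _) x0) _.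
by rewrite /upper_gamma_reg divff// gt_eqF// Gammaf_gt0.
Qed.

(** A Markov bound: on the tail [t > x] one has [1 <= (t / x) ^ j], and inserting this factor turns
    the integrand of parameter [a] into that of parameter [a + j]. *)
Lemma upper_gamma_reg_le_powR a j x : 0 < a -> 0 < j -> 0 < x ->
  upper_gamma_reg a x <= Gammaf (a + j) / Gammaf a * x `^ (- j).
Proof.
move=> a0 j0 x0; rewrite /upper_gamma_reg mulrAC ler_pM2r ?invr_gt0 ?Gammaf_gt0//.
have aj0 : 0 < a + j by rewrite addr_gt0.
have ij := gamma_integrableS _ _ aj0 (lexx 0).
have ijx := gamma_integrableS _ _ aj0 (ltW x0).
apply: (@le_trans _ _ (\int[mu]_(t in `]x, +oo[) (x `^ (- j) * gamma_integrand (a + j) t))).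
  apply: le_Rintegral => //.
  - by apply: gamma_integrableS => //; exact: ltW.
  - exact: integrableZl_EFin.
  move=> t /=; rewrite in_itv/= andbT => xt; have t0 := lt_trans x0 xt.
  rewrite /gamma_integrand addrAC (@powRD _ t (a - 1) j) ?(gt_eqF t0) ?implybT//.
  have -> : x `^ (- j) * (t `^ (a - 1) * t `^ j * expR (- t)) =
            (x `^ (- j) * t `^ j) * (t `^ (a - 1) * expR (- t)) by ring.
  rewrite ler_peMl ?mulr_ge0 ?powR_ge0 ?expR_ge0//.
  rewrite powRN mulrC ler_pdivlMr ?powR_gt0// mul1r.
  by apply: ge0_ler_powR; rewrite ?nnegrE ltW.
rewrite RintegralZl// mulrC ler_wpM2r ?powR_ge0//.
rewrite /Gammaf /Rintegral fine_le//.
- exact: integrable_fin_num.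
- exact: integrable_fin_num.
apply: ge0_subset_integral => //.
- exact: (@measurable_int _ _ _ mu).
- move=> t /=; rewrite in_itv/= andbT => xt; rewrite lee_fin.
  by apply/ltW/(gamma_integrand_gt0 (a + j)).
- by move=> t /=; rewrite !in_itv/= !andbT; exact: lt_trans.
Qed.

(** * Mass, negative moments and behaviour near 0 of the Nakagami density *)

(** Substitute [t = b * x ^+ 2] in the Gamma integral. With [b = m], this covers the normalization
    of the density ([a = m]) and its moments ([a = m - k]). *)
Lemma gamma_sqr a b : 0 < a -> 0 < b ->
  let h x : R := 2 * b `^ a * x `^ (2 * a - 1) * expR (- (b * x ^+ 2)) in
  mu.-integrable `]0, +oo[ (EFin \o h) /\ \int[mu]_(x in `]0, +oo[) h x = Gammaf a.
Proof.
move=> a0 b0 h.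
have hE x : 0 < x -> gamma_integrand a (b * x ^+ 2) * (2 * b * x) = h x.
  move=> x0; rewrite /gamma_integrand /h.
  rewrite powRM ?(ltW b0) ?sqr_ge0//.
  have x20 : 0 < x ^+ 2 by rewrite exprn_gt0.
  rewrite !powRB ?(gt_eqF x0) ?(gt_eqF b0) ?(gt_eqF x20) ?implybT//.
  rewrite powRrM !powRr1 ?(ltW b0) ?(ltW x0) ?sqr_ge0// powR_mulrn ?(ltW x0)//.
  by field; rewrite !gt_eqF.
have hI : (\int[mu]_(x in `]0%R, +oo[) (h x)%:E =
    \int[mu]_(x in `]0%R, +oo[) (gamma_integrand a x)%:E)%E.
  rewrite (sqr_substitution (gamma_integrand a) b b0); last 2 first.
  - exact: gamma_integrand_continuous.
  - by move=> x x0; exact/ltW/gamma_integrand_gt0.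
  apply: eq_integral => x; rewrite inE/= in_itv/= andbT => x0.
  by rewrite hE.
split; last by rewrite /Rintegral hI.
apply/integrableP; split.
  apply/measurable_EFinP; apply: measurable_funM => //.
    apply: measurable_funM => //; apply: measurable_funTS; exact: measurable_powR.
  apply: measurableT_comp => //; apply: measurableT_comp => //.
  apply: measurable_funM => //; exact: measurable_funX.
have := gamma_integrable a a0 => /integrableP[_].
rewrite [X in (X < _)%E -> _](_ : _ = \int[mu]_(x in `]0%R, +oo[) (gamma_integrand a x)%:E)%E; last first.
  apply: eq_integral => x; rewrite inE/= in_itv/= andbT => x0.
  by rewrite ger0_norm// ltW// gamma_integrand_gt0.
rewrite -hI; congr (_ < _)%E; apply: eq_integral => x.
rewrite inE/= in_itv/= andbT => x0.
by rewrite /= ger0_norm// /h !mulr_ge0 ?powR_ge0 ?expR_ge0.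
Qed.

Lemma nakagami_pdfE m k x : 0 < m -> 0 < x ->
  nakagami_pdf m x * (x ^+ 2) `^ (- k) =
  (m `^ k / Gammaf m) *
  (2 * m `^ (m - k) * x `^ (2 * (m - k) - 1) * expR (- (m * x ^+ 2))).
Proof.
move=> m0 x0; rewrite /nakagami_pdf mulNr.
have -> : 2 * (m - k) - 1 = (2 * m - 1) + - (2 * k) by ring.
rewrite (@powRD _ x (2 * m - 1) (- (2 * k))) ?(gt_eqF x0) ?implybT//.
rewrite (@powRB _ m m k) ?(gt_eqF m0) ?implybT//.
rewrite -[X in X `^ (- k)](powR_mulrn 2 (ltW x0)) -powRrM mulrN.
by field; rewrite !gt_eqF ?powR_gt0 ?Gammaf_gt0.
Qed.

(** The weight [x ^ (- 2 k)] shifts the Gamma parameter from [m] to [m - k], and [k < m] keeps it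
    positive. This is the source of the exponent [m] in the diversity order. *)
Lemma nakagami_moment_integrable m k : 0 < m -> k < m ->
  mu.-integrable `]0, +oo[ (EFin \o (fun x => nakagami_pdf m x * (x ^+ 2) `^ (- k))).
Proof.
move=> m0 km; have mk0 : 0 < m - k by lra.
have [ih _] := gamma_sqr _ _ mk0 m0.
have := integrableZl_EFin _ _ (m `^ k / Gammaf m) (measurable_itv _) ih.
apply: eq_integrable => // x; rewrite inE/= in_itv/= andbT => x0.
by rewrite nakagami_pdfE.
Qed.

Lemma nakagami_integrable m : 0 < m ->
  mu.-integrable `]0, +oo[ (EFin \o nakagami_pdf m).
Proof.
move=> m0; have := nakagami_moment_integrable m 0 m0 m0.
by apply: eq_integrable => // x _ /=; rewrite oppr0 powRr0 mulr1.
Qed.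

Lemma Rintegral_nakagami m : 0 < m ->
  \int[mu]_(x in `]0, +oo[) nakagami_pdf m x = 1.
Proof.
move=> m0; have [ih e] := gamma_sqr _ _ m0 m0.
rewrite -[RHS](@mulVf _ (Gammaf m)) ?gt_eqF ?Gammaf_gt0// -[X in _ = _ * X]e -RintegralZl//.
apply: eq_Rintegral => x; rewrite inE/= in_itv/= andbT => x0.
have := nakagami_pdfE m 0 x m0 x0.
by rewrite subr0 oppr0 !powRr0 mulr1 div1r.
Qed.

Lemma nakagami_ge0 m x : 0 < m -> 0 <= nakagami_pdf m x.
Proof.
move=> m0; rewrite /nakagami_pdf !mulr_ge0 ?powR_ge0 ?expR_ge0// invr_ge0.
exact/ltW/Gammaf_gt0.
Qed.

(** Near 0 the density is of order [x ^ (2 m - 1)], that is [x ^ (2 m) / x]: the numerator is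
    bounded using [d / 2 <= x] and the denominator using [x <= d], whatever the sign of [2 m - 1].
    The exponential is at least [expR (- m)] because [x <= 1]. *)
Lemma nakagami_ge m : 0 < m -> exists2 c, 0 < c &
  forall d, 0 < d <= 1 -> forall x, d / 2 <= x <= d ->
    c * d `^ (2 * m) / d <= nakagami_pdf m x.
Proof.
move=> m0.
exists (2 * m `^ m / Gammaf m * 2^-1 `^ (2 * m) * expR (- m)).
  by rewrite !mulr_gt0 ?powR_gt0 ?expR_gt0 ?invr_gt0 ?Gammaf_gt0.
move=> d /andP[d0 d1] x /andP[dx xd]; have x0 : 0 < x by lra.
have -> : nakagami_pdf m x =
    2 * m `^ m / Gammaf m * x `^ (2 * m - 1) * expR (- m * x ^+ 2).
  by rewrite /nakagami_pdf; ring.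
have xE : 2^-1 `^ (2 * m) * d `^ (2 * m) / d <= x `^ (2 * m - 1).
  rewrite (@powRB _ x (2 * m) 1) ?(gt_eqF x0) ?implybT// powRr1 ?(ltW x0)//.
  rewrite -powRM ?invr_ge0 ?(ltW d0)//.
  apply: ler_pM; rewrite ?powR_ge0 ?invr_ge0 ?(ltW d0)//.
    apply: ge0_ler_powR; rewrite ?nnegrE; [lra|lra|exact: ltW|].
    by rewrite mulrC.
  by rewrite lef_pV2.
have eE : expR (- m) <= expR (- m * x ^+ 2).
  by rewrite ler_expR mulNr lerN2 ler_piMr ?(ltW m0)// expr_le1 ?(ltW x0)//; lra.
pose A := 2 * m `^ m / Gammaf m.
have A0 : 0 <= A by rewrite divr_ge0 ?mulr_ge0 ?powR_ge0// ltW// Gammaf_gt0.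
rewrite -/A [leRHS](_ : _ = A * (x `^ (2 * m - 1) * expR (- m * x ^+ 2))); last by ring.
rewrite [leLHS](_ : _ =
    A * (2^-1 `^ (2 * m) * d `^ (2 * m) / d * expR (- m))); last by ring.
apply: ler_wpM2l => //; apply: ler_pM => //.
by rewrite divr_ge0 ?mulr_ge0 ?powR_ge0// ltW.
Qed.

(** * Elementary inequalities and logarithmic limits *)

(** The union bound over the [L] symbols. Together with [onem_exp_ge] it shows that the frame length
    affects constants but not the exponent. *)
Lemma onem_exp_le L x : 0 <= x <= 1 -> 1 - (1 - x) ^+ L <= L%:R * x.
Proof.
move=> /andP[x0 x1]; elim: L => [|L IH]; first by rewrite expr0 subrr mul0r.
have y0 : 0 <= (1 - x) ^+ L by rewrite exprn_ge0// subr_ge0.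
have y1 : (1 - x) ^+ L <= 1 by rewrite exprn_ile1// ?subr_ge0// lerBlDr lerDl.
rewrite exprS -natr1; nra.
Qed.

Lemma onem_exp_ge L x : (0 < L)%N -> 0 <= x <= 1 -> x <= 1 - (1 - x) ^+ L.
Proof.
case: L => // L _ /andP[x0 x1].
have y0 : 0 <= (1 - x) ^+ L by rewrite exprn_ge0// subr_ge0.
have y1 : (1 - x) ^+ L <= 1 by rewrite exprn_ile1// ?subr_ge0// lerBlDr lerDl.
rewrite exprS; nra.
Qed.

(** Constant factors disappear after division by [ln x]. The upper bound may lose an arbitrarily
    small exponent [e], since the moment bound is available only for [k] strictly below [m]. *)
Lemma cvg_ln_ratio f d :
  (exists2 c, 0 < c & forall x, 1 <= x -> c * x `^ (- d) <= f x) ->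
  (forall e : R, 0 < e ->
     exists2 c, 0 < c & forall x, 1 <= x -> f x <= c * x `^ (e - d)) ->
  ln (f x) / ln x @[x --> +oo] --> - d.
Proof.
move=> [c1 c10 fge] fle; apply/cvgrPdist_le => e e0.
(* In the upper estimate, half of the tolerance pays for the lost exponent and the other half
   absorbs [ln c2]; the lower estimate spends all of [e] on [ln c1]. *)
have e20 : 0 < e / 2 by lra.
have [c2 c20 {}fle] := fle _ e20.
have ln_ge (A : R) : \forall x \near +oo, A <= ln x.
  exists (expR A); split=> [|x Ax]; first by rewrite num_real.
  by rewrite -ler_expR lnK ?(ltW Ax)// posrE (lt_trans _ Ax)// expR_gt0.
near=> x.
have x1 : 1 <= x by near: x; apply: nbhs_pinfty_ge; rewrite num_real.
have x0 : 0 < x by exact: lt_le_trans x1.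
have l1 : 1 <= ln x by near: x; exact: ln_ge.
have l2 : - ln c1 / e <= ln x by near: x; exact: ln_ge.
have l3 : ln c2 / (e / 2) <= ln x by near: x; exact: ln_ge.
have l0 : 0 < ln x by lra.
have lb0 : 0 < c1 * x `^ (- d) by rewrite mulr_gt0// powR_gt0.
have f0 : 0 < f x := lt_le_trans lb0 (fge _ x1).
have lb : ln c1 - d * ln x <= ln (f x).
  have := fge _ x1; rewrite -(ler_ln lb0 f0).
  by rewrite lnM ?posrE ?powR_gt0// ln_powR mulNr.
have ub : ln (f x) <= ln c2 + (e / 2 - d) * ln x.
  have ub0 : 0 < c2 * x `^ (e / 2 - d) by rewrite mulr_gt0// powR_gt0.
  have := fle _ x1; rewrite -(ler_ln f0 ub0).
  by rewrite lnM ?posrE ?powR_gt0// ln_powR.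
rewrite ler_pdivrMr// in l2; rewrite ler_pdivrMr// in l3.
have q1 : ln (f x) / ln x <= e - d by rewrite ler_pdivrMr//; nra.
have q2 : - d - e <= ln (f x) / ln x by rewrite ler_pdivlMr//; nra.
by rewrite ler_norml; lra.
Unshelve. all: by end_near. Qed.

Lemma onem_exp_homo L x y : 0 <= x -> y <= 1 -> x <= y ->
  1 - (1 - x) ^+ L <= 1 - (1 - y) ^+ L.
Proof.
move=> x0 y1 xy; rewrite lerD2l lerN2.
by rewrite lerXn2r ?nnegrE ?subr_ge0 ?lerD2l ?lerN2// (le_trans xy).
Qed.

(** * The two polynomial bounds on the sphere lower bound *)

Definition radius_cst N : R := Gammaf (N%:R / 2 + 1) `^ (2 / N%:R) / pi.

(** The function u of the introduction: the frame error bound conditional on the product [s] of the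
    squared fading gains. *)
Definition outage N L rho s : R :=
  1 - (1 - upper_gamma_reg (N%:R / 2)
             (radius_cst N * s `^ (1 / N%:R) / 2 * rho)) ^+ L.

Lemma radius_cst_gt0 N : 0 < radius_cst N.
Proof.
by rewrite divr_gt0 ?pi_gt0// powR_gt0// Gammaf_gt0// ltr_wpDl// divr_ge0.
Qed.

Lemma half_gt0 N : (0 < N)%N -> 0 < N%:R / 2 :> R.
Proof. by move=> N0; rewrite divr_gt0// ltr0n. Qed.

Lemma upper_gamma_reg01 a x : 0 < a -> 0 <= x -> 0 <= upper_gamma_reg a x <= 1.
Proof.
by move=> a0 x0; rewrite upper_gamma_reg_le1// ltW// upper_gamma_reg_gt0.
Qed.

Lemma radius_ge0 N rho s : 0 <= rho ->
  0 <= radius_cst N * s `^ (1 / N%:R) / 2 * rho.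
Proof.
by move=> r0; rewrite mulr_ge0// divr_ge0// mulr_ge0 ?powR_ge0// ltW// radius_cst_gt0.
Qed.

Lemma outage01 N L rho s : (0 < N)%N -> 0 <= rho -> 0 <= outage N L rho s <= 1.
Proof.
move=> N0 r0; have /andP[u0 u1] :=
  upper_gamma_reg01 _ _ (half_gt0 N N0) (radius_ge0 N rho s r0).
rewrite subr_ge0 exprn_ile1 ?subr_ge0// ?lerBlDr ?lerDl//.
by rewrite exprn_ge0// subr_ge0.
Qed.

Lemma outage_decr N L rho s t : (0 < N)%N -> 0 <= rho -> 0 < s -> s <= t ->
  outage N L rho t <= outage N L rho s.
Proof.
move=> N0 r0 s0 st.
have h x := upper_gamma_reg01 _ _ (half_gt0 N N0) (radius_ge0 N rho x r0).
apply: onem_exp_homo; [by have /andP[] := h t|by have /andP[] := h s|].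
apply: upper_gamma_reg_decr; [exact: half_gt0|exact: radius_ge0|].
rewrite ler_wpM2r// ler_wpM2r// ler_wpM2l ?(ltW (radius_cst_gt0 _))//.
by apply: ge0_ler_powR; rewrite ?nnegrE ?divr_ge0//; lra.
Qed.

Lemma P_slbE N L m rho : (0 < N)%N -> 0 < m -> 0 <= rho ->
  P_slb N L m rho = prod_mean (nakagami_pdf m) (outage N L rho) N 1.
Proof.
move=> N0 m0 r0.
have p0 x : 0 < x -> 0 <= nakagami_pdf m x by move=> _; exact: nakagami_ge0.
have o_ni s t := outage_decr N L rho s t N0 r0.
have o01 s (_ : 0 < s) := outage01 N L rho s N0 r0.
have oE := prod_mean_onem _ _ p0 (nakagami_integrable m m0)
  (Rintegral_nakagami m m0) o_ni o01 N 1 ltr01.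
rewrite -[RHS](subKr 1) -oE.
congr (1 - _); rewrite /prod_mean; congr iid_expect; apply/funext => v.
by rewrite mul1r /outage [RHS]subKr.
Qed.

Lemma P_slb_le N L m k : (0 < N)%N -> 0 < k -> k < m ->
  exists2 c, 0 < c &
    forall rho, 0 < rho -> P_slb N L m rho <= c * rho `^ (- (k * N%:R)).
Proof.
move=> N0 k0 km; have m0 : 0 < m by lra.
have n0 : 0 < N%:R :> R by rewrite ltr0n.
(* With this [j], the power [- j] of [s ^ (1 / N)] is [s ^ (- k)], the shape required by
   [prod_mean_le]. *)
set j := k * N%:R; have j0 : 0 < j by rewrite mulr_gt0.
have [K KE K0] : exists2 K, radius_cst N = K & 0 < K.
  by exists (radius_cst N) => //; exact: radius_cst_gt0.
have a0 := half_gt0 N N0; set a := N%:R / 2 in a0.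
pose M := \int[mu]_(x in `]0, +oo[) (nakagami_pdf m x * (x ^+ 2) `^ (- k)).
have M0 : 0 <= M.
  by apply: Rintegral_ge0 => x _; rewrite mulr_ge0 ?nakagami_ge0 ?powR_ge0.
pose B := L%:R * (Gammaf (a + j) / Gammaf a) * (K / 2) `^ (- j).
have B0 : 0 <= B.
  by rewrite !mulr_ge0 ?powR_ge0 ?invr_ge0// ltW// Gammaf_gt0// addr_gt0.
(* The product [B * M ^+ N] is only known to be nonnegative; adding 1 makes the constant
   positive. *)
exists (B * M ^+ N + 1).
  by rewrite ltr_wpDl// mulr_ge0// exprn_ge0.
move=> rho r0; rewrite P_slbE ?(ltW r0)//.
have outage_le s : 0 < s -> outage N L rho s <= B * rho `^ (- j) * s `^ (- k).
  move=> s0; have s10 : 0 < s `^ (1 / N%:R) by rewrite powR_gt0.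
  have z0 : 0 < K * s `^ (1 / N%:R) / 2 * rho by rewrite mulr_gt0// divr_gt0// mulr_gt0.
  rewrite /outage KE; apply: le_trans (onem_exp_le _ _ (upper_gamma_reg01 _ _ a0 (ltW z0))) _.
  have -> : B * rho `^ (- j) * s `^ (- k) =
    L%:R * (Gammaf (a + j) / Gammaf a * (K * s `^ (1 / N%:R) / 2 * rho) `^ (- j)).
    have -> : K * s `^ (1 / N%:R) / 2 * rho = (K / 2) * rho * s `^ (1 / N%:R).
      by ring.
    rewrite !powRM ?mulr_ge0 ?invr_ge0 ?(ltW r0) ?(ltW K0) ?powR_ge0//.
    rewrite -powRrM (_ : 1 / N%:R * - j = - k).
      by rewrite /B !powRM ?invr_ge0 ?(ltW K0)//; ring.
    by rewrite /j; field; rewrite gt_eqF.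
  by rewrite ler_wpM2l//; exact: upper_gamma_reg_le_powR.
have BR0 : 0 <= B * rho `^ (- j) by rewrite mulr_ge0// powR_ge0.
have p0 x : 0 < x -> 0 <= nakagami_pdf m x by move=> _; exact: nakagami_ge0.
apply: le_trans (prod_mean_le _ _ p0 (nakagami_integrable m m0)
  (Rintegral_nakagami m m0) _ _ _ _ _ _ BR0
  (nakagami_moment_integrable m k m0 km) outage_le ltr01) _.
- by move=> s t; apply: outage_decr => //; exact: ltW.
- by move=> s _; apply: outage01 => //; exact: ltW.
rewrite -/M powR1 mulr1 mulrAC ler_wpM2r ?powR_ge0// lerDl//.
Qed.

Lemma P_slb_ge N L m : (0 < N)%N -> (0 < L)%N -> 0 < m ->
  exists2 c, 0 < c &
    forall rho, 1 <= rho -> c * rho `^ (- (m * N%:R)) <= P_slb N L m rho.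
Proof.
move=> N0 L0 m0; have n0 : 0 < N%:R :> R by rewrite ltr0n.
have [K KE K0] : exists2 K, radius_cst N = K & 0 < K.
  by exists (radius_cst N) => //; exact: radius_cst_gt0.
have a0 := half_gt0 N N0; set a := N%:R / 2 in a0.
have [c c0 pge] := nakagami_ge m m0.
have K20 : 0 <= K / 2 by rewrite divr_ge0// ltW.
have u0 := upper_gamma_reg_gt0 _ _ a0 K20.
exists (upper_gamma_reg a (K / 2) * (c / 2) ^+ N).
  by rewrite mulr_gt0// exprn_gt0// divr_gt0.
move=> rho r1; have r0 : 0 < rho by lra.
(* If every gain is [d], the product of the squares is [rho ^ (- N)]; its [N]-th root cancels the
   factor [rho], so the argument of the incomplete Gamma function is the constant [K / 2]. *)
pose d := (Num.sqrt rho)^-1.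
have d0 : 0 < d by rewrite invr_gt0 sqrtr_gt0.
have d1 : d <= 1 by rewrite invf_le1 ?sqrtr_gt0// -sqrtr1 ler_wsqrtr.
have d2 : d ^+ 2 = rho^-1 by rewrite exprVn sqr_sqrtr// ltW.
have p0 x : 0 < x -> 0 <= nakagami_pdf m x by move=> _; exact: nakagami_ge0.
have cd0 : 0 <= c * d `^ (2 * m) / d.
  by rewrite !mulr_ge0 ?powR_ge0 ?invr_ge0// ltW.
have d01 : 0 < d <= 1 by rewrite d0.
rewrite P_slbE ?(ltW r0)//.
have := prod_mean_ge _ _ p0 (nakagami_integrable m m0)
  (Rintegral_nakagami m m0) _ _ _ _ N 1 cd0 d0 (pge _ d01) ltr01.
move=> /(_ (outage N L rho)) h; apply: le_trans (h _ _); last 2 first.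
- by move=> s t; apply: outage_decr => //; exact: ltW.
- by move=> s _; apply: outage01 => //; exact: ltW.
rewrite mul1r d2.
(* The lower bound on the probability that one gain lies in [[d / 2, d]]; its [N]-th power yields
   the exponent [- m N]. *)
have -> : c * d `^ (2 * m) / d * (d / 2) = c / 2 * rho `^ (- m).
  rewrite powRrM (powR_mulrn 2) ?(ltW d0)// d2.
  rewrite -powR_inv1 ?(ltW r0)// -powRrM mulN1r.
  by field; rewrite gt_eqF.
rewrite (exprMn N (c / 2)) -(powR_mulrn N (powR_ge0 rho (- m))) -powRrM mulNr.
rewrite -mulrA; apply: ler_wpM2r.
  by rewrite mulr_ge0 ?powR_ge0// exprn_ge0// divr_ge0// ltW.
have e : K * (rho^-1 ^+ N) `^ (1 / N%:R) / 2 * rho = K / 2.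
  rewrite -powR_mulrn ?invr_ge0 ?(ltW r0)// -powRrM mulrCA divff ?gt_eqF//.
  rewrite mulr1 powRr1 ?invr_ge0 ?(ltW r0)//.
  by field; rewrite gt_eqF.
rewrite /outage KE -/a e; apply: onem_exp_ge => //.
exact: upper_gamma_reg01.
Qed.
End aux.

(** * The diversity order *)

Theorem theorem1 (R : realType) (N L : nat) (m : R) :
  (0 < N)%N -> (0 < L)%N -> 0 < m ->
  (ln (P_slb N L m rho) / ln rho) @[rho --> +oo] --> - (m * N%:R).
Proof.
move=> N0 L0 m0; apply: cvg_ln_ratio; first exact: P_slb_ge.
move=> e e0; have n0 : 0 < N%:R :> R by rewrite ltr0n.
(* The first term ensures [m N - e <= k N]; the second keeps [k] positive when [e] is large. Both
   are below [m]. *)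
pose k := Num.max (m - e / N%:R) (m / 2).
have k0 : 0 < k by rewrite lt_max orbC divr_gt0.
have km : k < m.
  by rewrite gt_max ltrBlDr ltrDl divr_gt0//=; lra.
have [c c0 cP] := P_slb_le N L m k N0 k0 km.
exists c => // rho r1; apply: le_trans (cP _ (lt_le_trans ltr01 r1)) _.
rewrite ler_wpM2l ?(ltW c0)//; apply: ler_powR => //.
have : m - e / N%:R <= k by rewrite le_max lexx.
rewrite -(ler_pM2r n0) mulrBl divfK ?gt_eqF//; lra.
Qed.
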